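(* For every labelled transition system $T$, the labelled transition system $\mathsf{ks}^{-1}(Q)$, where $Q$ is the quotient of the Kripke structure $\mathsf{ks}(T)$ with respect to bisimilarity, is isomorphic to the quotient of $T$ with respect to strong bisimilarity; i.e. $\mathrm{min}^{\leftrightarrow}_{\mathsf{LTS}}=\mathsf{ks}^{-1}\circ\mathrm{min}^{\leftrightarrow}_{\mathsf{KS}}\circ\mathsf{ks}$.
   Context: A Kripke structure is $K=\langle S, AP, \to, L\rangle$ with $S$ a set of states, $AP$ a set of atomic propositions, $\to\,\subseteq S\times S$ a total transition relation, and $L: S\to 2^{AP}$. A labelled transition system (LTS) is $T=\langle S, Act, \to\rangle$ with a special silent action $\tau\notin Act$ and a total transition relation $\to\,\subseteq S\times(Act\cup\{\tau\})\times S$. The embedding $\mathsf{ks}$: $\mathsf{ks}(T)=\langle S', AP, \to', L\rangle$ where $S' = S\cup\{(s,a,t)\in\,\to \mid a\neq\tau\}$, $AP = Act\cup\{\bot\}$ with $\bot\notin Act$ fresh, $\to'$ is the least relation such that for every transition $(s,a,t)$ with $a\neq\tau$, $s\to'(s,a,t)$ and $(s,a,t)\to' t$, and $s\to' t$ whenever $s\xrightarrow{\tau}t$; $L(s)=\{\bot\}$ for $s\in S$ and $L((s,a,t))=\{a\}$. Reversibility: a Kripke structure is reversible iff (1) $AP = Act\cup\{\bot\}$ for some set $Act$; (2) $|L(s)|=1$ for all states; (3) for every $s$ with $\bot\notin L(s)$, $s\to s'$ and $s\to s''$ imply $s'=s''$ and $L(s')=\{\bot\}$. For a reversible $K$, $\mathsf{ks}^{-1}(K)=\langle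 S'',Act,\to''\rangle$ with $S''=\{s\mid L(s)=\{\bot\}\}$, $Act=AP\setminus\{\bot\}$, and $\to''$ the least relation with $s\xrightarrow{\tau}s'$ whenever $s\to s'$ and $L(s)=L(s')$, and $s\xrightarrow{a}s'$ whenever $s\to s''$, $a\in L(s'')\setminus\{\bot\}$ and $s''\to s'$. Bisimilarity in a Kripke structure: $B$ is a simulation iff for all $(s,s')\in B$, $L(s)=L(s')$ and each $s\to t$ is matched by some $s'\to t'$ with $(t,t')\in B$; bisimilar iff some symmetric simulation contains the pair. Strong bisimilarity in an LTS: same without the label condition, each $s\xrightarrow{a}t$ matched by $s'\xrightarrow{a}t'$ with $(t,t')\in B$. Quotients, $[s]$ the class: bisimilarity quotient of a Kripke structure: classes as states, $[s]\to[t]$ iff $s_1\to t_1$ for some $s_1\in[s],t_1\in[t]$, $L([s])=L(s)$; strong bisimilarity quotient of an LTS: classes as states, $[s]\xrightarrow{a}[t]$ iff $s_1\xrightarrow{a}t_1$ for some representatives. $\mathrm{min}$ maps a structure to (a fixed representative of) its quotient; equality is up to isomorphism. *)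

(* Defs.v *)
From mathcomp Require Import all_boot boolp classical_sets.

Set Implicit Arguments.
Unset Strict Implicit.
Unset Printing Implicit Defensive.

Local Open Scope classical_set_scope.

(* Sets of atomic propositions and of actions are subsets of an ambient type
   of names. Names being shared, equations between such sets, such as
   AP = Act `|` {bot} or equality of two action alphabets, are literal. *)

Record kripke (V : Type) := Kripke {
  kstate : Type;
  AP : set V;
  kstep : kstate -> kstate -> Prop;
  klabel : kstate -> set V;
  klabel_AP : forall s, klabel s `<=` AP;
  kstep_total : forall s, exists t, kstep s t }.

(* In an LTS with actions in A, None : option A is the silent action; in a
   Kripke structure with propositions in option A, None is the fresh
   proposition bot. *)
Notation tau := None (only parsing).
Notation bot := None (only parsing).

Record lts (A : Type) := Lts {
  lstate : Type;
  Act : set A;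
  lstep : lstate -> option A -> lstate -> Prop;
  lstep_Act : forall s a t, lstep s (Some a) t -> Act a;
  lstep_total : forall s, exists a t, lstep s a t }.

Section Bisimilarity.
Variables (V A : Type) (K : kripke V) (T : lts A).

Definition ksimulation (B : kstate K -> kstate K -> Prop) : Prop :=
  forall s s', B s s' ->
    klabel s = klabel s' /\
    forall t, kstep s t -> exists t', kstep s' t' /\ B t t'.

Definition kbisimilar (s s' : kstate K) : Prop :=
  exists B, [/\ ksimulation B, (forall x y, B x y -> B y x) & B s s'].

Definition lsimulation (B : lstate T -> lstate T -> Prop) : Prop :=
  forall s s', B s s' ->
    forall a t, lstep s a t -> exists t', lstep s' a t' /\ B t t'.

Definition lbisimilar (s s' : lstate T) : Prop :=
  exists B, [/\ lsimulation B, (forall x y, B x y -> B y x) & B s s'].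

Lemma kbisimilar_refl s : kbisimilar s s.
Proof.
exists eq; split=> //; move=> x _ <-; split=> // t xt.
by exists t.
Qed.

Lemma lbisimilar_refl s : lbisimilar s s.
Proof.
exists eq; split=> //; move=> x _ <- a t xt.
by exists t.
Qed.

End Bisimilarity.

Section Quotients.

Definition classes (S : Type) (R : S -> S -> Prop) : Type :=
  {C : set S | exists s, C = [set t | R s t]}.

Definition class (S : Type) (R : S -> S -> Prop) (s : S) : classes R :=
  exist _ [set t | R s t] (ex_intro _ s erefl).

Variables (V A : Type) (K : kripke V) (T : lts A).

Definition kmin_step (C D : classes (@kbisimilar V K)) : Prop :=
  exists s t, [/\ sval C s, sval D t & kstep s t].

(* All members of a class have the same label (see kmin_label_class). *)
Definition kmin_label (C : classes (@kbisimilar V K)) : set V :=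
  \bigcup_(s in sval C) klabel s.

Lemma kmin_label_class (s : kstate K) :
  kmin_label (class (@kbisimilar V K) s) = klabel s.
Proof.
apply/seteqP; split=> [p [t Ct tp]|p sp].
  have [B [simB _ st]] := Ct.
  by have [eq_st _] := simB _ _ st; rewrite eq_st.
by exists s => //; exact: kbisimilar_refl.
Qed.

Lemma kmin_label_AP C : kmin_label C `<=` AP K.
Proof. by move=> p [s _ sp]; exact: klabel_AP sp. Qed.

Lemma kmin_step_total C : exists D, kmin_step C D.
Proof.
have [s Cs] := svalP C; have [t st] := kstep_total s.
exists (class _ t), s, t; split=> //; last exact: kbisimilar_refl.
by rewrite Cs; exact: kbisimilar_refl.
Qed.

Definition kmin : kripke V := Kripke kmin_label_AP kmin_step_total.

Definition lmin_step (C : classes (@lbisimilar A T)) (a : option A)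
    (D : classes (@lbisimilar A T)) : Prop :=
  exists s t, [/\ sval C s, sval D t & lstep s a t].

Lemma lmin_step_Act C a D : lmin_step C (Some a) D -> Act T a.
Proof. by move=> [s [t [_ _ st]]]; exact: lstep_Act st. Qed.

Lemma lmin_step_total C : exists a D, lmin_step C a D.
Proof.
have [s Cs] := svalP C; have [a [t st]] := lstep_total s.
exists a, (class _ t), s, t; split=> //; last exact: lbisimilar_refl.
by rewrite Cs; exact: lbisimilar_refl.
Qed.

Definition lmin : lts A := Lts lmin_step_Act lmin_step_total.

End Quotients.

Section Embedding.
Variables (A : Type) (T : lts A).

Definition visible : Type :=
  {x : lstate T * A * lstate T | lstep x.1.1 (Some x.1.2) x.2}.

Definition ks_state : Type := (lstate T + visible)%type.

Inductive ks_step : ks_state -> ks_state -> Prop :=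
| ks_step_in (x : visible) : ks_step (inl (sval x).1.1) (inr x)
| ks_step_out (x : visible) : ks_step (inr x) (inl (sval x).2)
| ks_step_tau s t : lstep s tau t -> ks_step (inl s) (inl t).

Definition ks_AP : set (option A) := Some @` Act T `|` [set bot].

Definition ks_label (x : ks_state) : set (option A) :=
  match x with
  | inl _ => [set bot]
  | inr x => [set Some (sval x).1.2]
  end.

Lemma ks_label_AP x : ks_label x `<=` ks_AP.
Proof.
case: x => [s|[[[s a] t] sat]] p /= ->; first by right.
by left; exists a => //; exact: lstep_Act sat.
Qed.

Lemma ks_step_total x : exists y, ks_step x y.
Proof.
case: x => [s|x]; last by exists (inl (sval x).2); constructor.
have [[a|] [t st]] := lstep_total s; last by exists (inl t); constructor.
by exists (inr (exist _ (s, a, t) st)); exact: (ks_step_in (exist _ (s, a, t) st)).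
Qed.

Definition ks : kripke (option A) := Kripke ks_label_AP ks_step_total.

End Embedding.

Section Inverse.
Variable A : Type.

Definition reversible (K : kripke (option A)) : Prop :=
  [/\ exists B : set A, AP K = Some @` B `|` [set bot],
      forall s : kstate K, exists p, klabel s = [set p]
    & forall s : kstate K, ~ klabel s bot ->
        forall s' s'', kstep s s' -> kstep s s'' ->
          s' = s'' /\ klabel s' = [set bot]].

Variables (K : kripke (option A)) (revK : reversible K).

Definition ksinv_state : Type := {s : kstate K | klabel s = [set bot]}.

(* AP minus bot, as a set of names of actions *)
Definition ksinv_Act : set A := [set a | AP K (Some a)].

Inductive ksinv_step : ksinv_state -> option A -> ksinv_state -> Prop :=
| ksinv_step_tau (s s' : ksinv_state) :
    kstep (sval s) (sval s') -> klabel (sval s) = klabel (sval s') ->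
    ksinv_step s tau s'
| ksinv_step_act (s s' : ksinv_state) (s'' : kstate K) (a : A) :
    kstep (sval s) s'' -> klabel s'' (Some a) -> kstep s'' (sval s') ->
    ksinv_step s (Some a) s'.

Lemma ksinv_step_Act s a t : ksinv_step s (Some a) t -> ksinv_Act a.
Proof.
move E: (Some a) => o st; case: st E => // u u' v b _ vb _ [->].
exact: klabel_AP vb.
Qed.

Lemma ksinv_step_total s : exists a t, ksinv_step s a t.
Proof.
have [_ lab1 det] := revK; have [t st] := kstep_total (sval s).
have [[a|] tl] := lab1 t; last first.
  exists tau, (exist _ t tl); apply: ksinv_step_tau => //=.
  by rewrite tl; exact: (svalP s).
have [u tu] := kstep_total t.
have ul : klabel u = [set bot].
  by apply: (proj2 (det t _ u u tu tu)); rewrite tl.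
exists (Some a), (exist _ u ul).
by apply: (@ksinv_step_act s (exist _ u ul) t a st _ tu); rewrite tl.
Qed.

Definition ksinv : lts A := Lts ksinv_step_Act ksinv_step_total.

End Inverse.

Definition lts_iso (A : Type) (T1 T2 : lts A) : Prop :=
  Act T1 = Act T2 /\
  exists f : lstate T1 -> lstate T2,
    bijective f /\
    forall s a t, lstep s a t <-> lstep (f s) a (f t).

(* Main.v *)
Require Import Defs.
From mathcomp Require Import all_boot boolp classical_sets.

(** The two bisimilarities agree on the states of [T]: [s] and [t] are strongly
    bisimilar in [T] iff they are bisimilar in [ks T]. Bisimilar states of
    [ks T] have equal labels, so the classes of [ks T] labelled [bot] consist of
    states of [T] only, and are exactly the strong bisimilarity classes of [T].
    All members of a class labelled [a <> bot] are transitions labelled [a],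
    each with a unique successor; these successors are bisimilar, so the class
    itself has a unique successor. This gives both reversibility and the
    correspondence between two-step paths through such a class and
    [a]-transitions of the quotient of [T]. *)

Set Implicit Arguments.
Unset Strict Implicit.
Unset Printing Implicit Defensive.

Local Open Scope classical_set_scope.

(** Proof irrelevance reduces equality of classes to equality of their underlying sets. *)
Lemma class_eq (S : Type) (R : S -> S -> Prop)
    (symR : forall x y, R x y -> R y x)
    (transR : forall x y z, R x y -> R y z -> R x z) (C : classes R) (x : S) :
  sval C x -> C = class R x.
Proof.
case: C => C exC /= Cx; apply: eq_exist.
have [y CE] := exC; move: Cx; rewrite CE => yx; apply/seteqP; split=> z /=.
  by apply: transR; exact: symR.
exact: transR.
Qed.

Section KripkeQuotient.
Variables (V : Type) (K : kripke V).

Lemma kbisimilar_sym (x y : kstate K) : kbisimilar x y -> kbisimilar y x.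
Proof. by move=> [B [simB symB xy]]; exists B; split=> //; exact: symB. Qed.

Lemma kbisimilar_label (x y : kstate K) :
  kbisimilar x y -> klabel x = klabel y.
Proof. by move=> [B [simB _ /simB[]]]. Qed.

Lemma kbisimilar_step (x y x' : kstate K) : kbisimilar x y -> kstep x x' ->
  exists2 y', kstep y y' & kbisimilar x' y'.
Proof.
move=> [B [simB symB /simB[_ xy]]] /xy[y' [yy' x'y']].
by exists y' => //; exists B.
Qed.

Lemma kbisimilar_trans (x y z : kstate K) :
  kbisimilar x y -> kbisimilar y z -> kbisimilar x z.
Proof.
move=> xy yz.
(* Composing the two given bisimulations need not yield a symmetric relation; composing bisimilarity
   with itself does. *)
exists (fun x z => exists2 y, kbisimilar x y & kbisimilar y z); split.
- move=> {xy yz} {}x {}z [{}y xy yz]; split.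
    by rewrite (kbisimilar_label xy) (kbisimilar_label yz).
  move=> x' /(kbisimilar_step xy)[y' /(kbisimilar_step yz)[z' zz' yz'] xy'].
  by exists z'; split=> //; exists y'.
- by move=> {xy yz} {}x {}z [{}y xy yz]; exists y; exact: kbisimilar_sym.
- by exists y.
Qed.

Lemma kclass_eq (C : classes (@kbisimilar V K)) (x : kstate K) :
  sval C x -> C = class _ x.
Proof. exact: class_eq kbisimilar_sym kbisimilar_trans _ _. Qed.

Lemma kmin_label_mem (C : classes (@kbisimilar V K)) (x : kstate K) :
  sval C x -> kmin_label C = klabel x.
Proof. by move=> /kclass_eq ->; exact: kmin_label_class. Qed.

(** A quotient step comes from some representative; bisimilarity transfers it to any chosen one. *)
Lemma kmin_step_mem (C D : classes (@kbisimilar V K)) (x : kstate K) :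
  kmin_step C D -> sval C x -> exists2 y, kstep x y & sval D y.
Proof.
move=> [x0 [y0 [Cx0 Dy0 xy0]]] Cx.
have x0x : kbisimilar x0 x by move: Cx; rewrite (kclass_eq Cx0).
have [y xy yy0] := kbisimilar_step x0x xy0.
by exists y => //; rewrite (kclass_eq Dy0).
Qed.

End KripkeQuotient.

Section LtsQuotient.
Variables (A : Type) (T : lts A).

Lemma lbisimilar_sym (s t : lstate T) : lbisimilar s t -> lbisimilar t s.
Proof. by move=> [B [simB symB st]]; exists B; split=> //; exact: symB. Qed.

Lemma lbisimilar_step (s t s' : lstate T) a : lbisimilar s t -> lstep s a s' ->
  exists2 t', lstep t a t' & lbisimilar s' t'.
Proof.
move=> [B [simB symB /simB st]] /st[t' [tt' s't']].
by exists t' => //; exists B.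
Qed.

End LtsQuotient.

Section Embedding.
Variables (A : Type) (T : lts A).

Lemma ks_step_tauP (s t : lstate T) :
  ks_step (inl s) (inl t) <-> lstep s None t.
Proof. by split=> [st|]; [inversion st | exact: ks_step_tau]. Qed.

Lemma ks_step_inP (s : lstate T) (v : visible T) :
  ks_step (inl s) (inr v) <-> (sval v).1.1 = s.
Proof. by split=> [sv|<-]; [inversion sv | exact: ks_step_in]. Qed.

Lemma ks_step_outP (v : visible T) (y : ks_state T) :
  ks_step (inr v) y <-> y = inl (sval v).2.
Proof. by split=> [vy|->]; [inversion vy | exact: ks_step_out]. Qed.

Lemma ks_label_bot (x : ks_state T) :
  ks_label x = [set None] -> exists s, x = inl s.
Proof.
case: x => [s _|v /= /seteqP[/(_ _ erefl)]]; first by exists s.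
by [].
Qed.

Lemma ks_label_act (x : ks_state T) (a : A) : ks_label x (Some a) ->
  exists s t (sat : lstep s (Some a) t),
    x = inr (exist (fun x => lstep x.1.1 (Some x.1.2) x.2) (s, a, t) sat).
Proof. by case: x => [//|[[[s b] t] sbt] /= [ab]]; subst b; exists s, t, sbt. Qed.

Lemma kbisimilar_inl (s t : lstate T) :
  @kbisimilar _ (ks T) (inl s) (inl t) <-> lbisimilar s t.
Proof.
split=> [st|st].
  exists (fun s t => @kbisimilar _ (ks T) (inl s) (inl t)); split=> //.
    move=> {st} {}s {}t st [a|] s' ss'.
      (* A visible step is matched in two halves: the state matching [v] has label [a], so it is an
         [a]-transition out of [t], and its only successor matches [s']. *)
      pose v : visible T := exist _ (s, a, s') ss'.
      have [y ty vy] := @kbisimilar_step _ (ks T) _ _ (inr v) st (ks_step_in v).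
      have /ks_label_act[t0 [t' [t0t' yE]]] : ks_label y (Some a).
        by move: (kbisimilar_label vy) => /= <-.
      move: ty vy; rewrite yE => /ks_step_inP/= t0E.
      move=> /kbisimilar_step /(_ (ks_step_out v))[_ /ks_step_outP -> /= s't'].
      by exists t'; rewrite -t0E.
    have [y ty s'y] :=
      @kbisimilar_step _ (ks T) _ _ (inl s') st (ks_step_tau ss').
    (* The label rules out a match by a transition state. *)
    have /ks_label_bot[t' yE] := esym (kbisimilar_label s'y).
    by move: ty s'y; rewrite yE => /ks_step_tauP tt' s't'; exists t'.
  by move=> *; exact: kbisimilar_sym.
(* The sources of two transitions need not be compared: a transition state only shows its action and
   moves to its target. *)
pose B (x y : ks_state T) := match x, y with
  | inl s, inl t => lbisimilar s t
  | inr v, inr w =>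
      (sval v).1.2 = (sval w).1.2 /\ lbisimilar (sval v).2 (sval w).2
  | _, _ => False
  end.
exists B; split=> // [[s1|v] [t1|w] //=|[s1|v] [t1|w] //=].
- move=> st1; split=> // -[s2 /ks_step_tauP|[[[s0 a] s2] s0s2]].
    by move=> /(lbisimilar_step st1)[t2 tt2 ?]; exists (inl t2); split=> //;
      apply/ks_step_tauP.
  move=> /ks_step_inP/= s0E; move: s0s2; rewrite s0E => s12.
  have [t2 t12 st2] := lbisimilar_step st1 s12.
  by exists (inr (exist _ (t1, a, t2) t12)); split=> //; apply/ks_step_inP.
- move=> [-> vw]; split=> // _ /ks_step_outP ->.
  by exists (inl (sval w).2); split=> //; apply/ks_step_outP.
- exact: lbisimilar_sym.
- by move=> [-> /lbisimilar_sym].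
Qed.

Lemma kmin_label_bot (C : kstate (kmin (ks T))) (x : kstate (ks T)) :
  klabel C = [set None] -> sval C x -> exists s, x = inl s.
Proof.
move=> C_bot /kmin_label_mem Cx; apply: ks_label_bot; rewrite -C_bot.
exact: esym Cx.
Qed.

Lemma reversible_kmin_ks : reversible (kmin (ks T)).
Proof.
split.
- by exists (Act T).
- move=> C; have [x Cx] := svalP C.
  have {}Cx : sval C x by rewrite Cx; exact: kbisimilar_refl.
  by rewrite /= (kmin_label_mem Cx); case: (x) => [s|v]; eexists.
- move=> C C_nbot D1 D2 CD1 CD2; have [x Cx] := svalP C.
  have {}Cx : sval C x by rewrite Cx; exact: kbisimilar_refl.
  move: C_nbot; rewrite /= (kmin_label_mem Cx).
  case: x Cx => [s _ []//|v Cv _].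
  (* Both successor classes contain the target of [v], hence coincide. *)
  have [_ /ks_step_outP -> D1v] := kmin_step_mem CD1 Cv.
  have [_ /ks_step_outP -> D2v] := kmin_step_mem CD2 Cv.
  by rewrite (kclass_eq D1v) (kclass_eq D2v) kmin_label_class.
Qed.

Lemma inl_preimage_class (C : ksinv_state (kmin (ks T))) :
  exists s, [set t | sval (sval C) (inl t)] = [set t | lbisimilar s t].
Proof.
have [x CE] := svalP (sval C).
have Cx : sval (sval C) x by rewrite CE; exact: kbisimilar_refl.
have [s xE] := kmin_label_bot (svalP C) Cx.
by exists s; apply/seteqP; split=> t; rewrite /= CE xE => /kbisimilar_inl.
Qed.

(** Taking the preimage along [inl] gives the isomorphism without choosing representatives; its
    inverse [kclass_of] takes the image. *)
Definition lclass_of (C : ksinv_state (kmin (ks T))) :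
    classes (@lbisimilar A T) :=
  exist _ _ (inl_preimage_class C).

(** The image is already a full class, since the label [bot] keeps transition states out of it. *)
Lemma inl_image_class (D : classes (@lbisimilar A T)) :
  exists x, inl @` sval D = [set y | @kbisimilar _ (ks T) x y].
Proof.
have [s ->] := svalP D; exists (inl s); apply/seteqP; split.
  by move=> _ [t st <-]; apply/kbisimilar_inl.
move=> y sy; have [t yE] := ks_label_bot (esym (kbisimilar_label sy)).
by exists t => //; apply/kbisimilar_inl; rewrite -yE.
Qed.

Lemma inl_image_label (D : classes (@lbisimilar A T)) :
  @klabel _ (kmin (ks T)) (exist _ _ (inl_image_class D)) = [set None].
Proof.
have [s Ds] := svalP D; rewrite /= (@kmin_label_mem _ (ks T) _ (inl s)) //=.
by exists s => //; rewrite Ds; exact: lbisimilar_refl.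
Qed.

Definition kclass_of (D : classes (@lbisimilar A T)) :
    ksinv_state (kmin (ks T)) :=
  exist _ _ (inl_image_label D).

Lemma lclass_of_bij : bijective lclass_of.
Proof.
exists kclass_of.
  (* Two layers of proofs are discarded: that the label is [bot], and that the set is a class. *)
  case=> [[C exC] C_bot]; do 2!apply: eq_exist; apply/seteqP; split=> x /=.
    by move=> [s Cs <-].
  by move=> Cx; have [s xE] := kmin_label_bot C_bot Cx; exists s; rewrite -?xE.
case=> [D exD]; apply: eq_exist; apply/seteqP; split=> s /=.
  by move=> [t Dt [<-]].
by exists s.
Qed.

Lemma lclass_of_step (C D : ksinv_state (kmin (ks T))) (a : option A) :
  ksinv_step C a D <-> lmin_step (lclass_of C) a (lclass_of D).
Proof.
split=> [|[s [t [/= Cs Dt]]]].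
  case=> {C D a} [C D [x [y [Cx Dy xy]]] _|C D E a [x [y [Cx Ey xy]]] Ea ED].
    have [s xE] := kmin_label_bot (svalP C) Cx.
    have [t yE] := kmin_label_bot (svalP D) Dy.
    subst x y; exists s, t; split=> //; exact/ks_step_tauP.
  have [s xE] := kmin_label_bot (svalP C) Cx.
  have /ks_label_act[s0 [t [st yE]]] : ks_label y (Some a).
    by move: Ea; rewrite /= (kmin_label_mem Ey).
  subst x y; move: xy => /ks_step_inP/= s0E; subst s0.
  (* The step out of [E] is replayed from the same member [y] that the step into [E] reached, so
     both halves belong to one transition of [T]. *)
  have [_ /ks_step_outP -> /= Dt] := kmin_step_mem ED Ey.
  by exists s, t.
case: a => [a|] st.
  pose v : visible T := exist _ (s, a, t) st.
  (* The intermediate state is the class of the transition itself. *)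
  apply: (@ksinv_step_act _ _ C D (class (@kbisimilar _ (ks T)) (inr v))).
  - exists (inl s), (inr v); split=> //; first exact: kbisimilar_refl.
    exact: (ks_step_in v).
  - by rewrite /= kmin_label_class.
  - exists (inr v), (inl t); split=> //; first exact: kbisimilar_refl.
    exact: (ks_step_out v).
apply: ksinv_step_tau; last by rewrite (svalP C) (svalP D).
by exists (inl s), (inl t); split=> //; exact: ks_step_tau.
Qed.

Lemma ksinv_Act_ks : ksinv_Act (kmin (ks T)) = Act T.
Proof.
apply/seteqP; split=> [a [[b Tb [<-]]|]//|a Ta].
by left; exists a.
Qed.

End Embedding.

Theorem theorem4p15 (A : Type) (T : lts A) :
  exists rev : reversible (kmin (ks T)), lts_iso (ksinv rev) (lmin T).
Proof.
exists (reversible_kmin_ks T); split; first exact: ksinv_Act_ks.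
exists (@lclass_of A T); split; first exact: lclass_of_bij.
by move=> C a D; exact: lclass_of_step.
Qed.
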